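(* Let $m<p$ be positive integers, $\Sigma_m=\{0,\dots,m\}$, and let $f:\Sigma_m\to\{0,\dots,p\}$ be strictly increasing with $f(0)=0$ and $f(m)=p$. Let $\{C_n\}$ be the associated Cantor-integers and $\alpha=\log(p+1)/\log(m+1)$. Then the set $\{C_n/n^\alpha: n\ge1\}$ is dense in the closed interval $\big[\inf_{n\ge1}C_n/n^\alpha,\ \sup_{n\ge1}C_n/n^\alpha\big]$.
   Context: Cantor-integers: for an integer $n\ge0$ with base-$(m+1)$ expansion $n=\sum_{j=0}^k\epsilon_j(m+1)^j$, $\epsilon_j\in\Sigma_m$, define $C_n=\sum_{j=0}^k f(\epsilon_j)(p+1)^j$. *)

(* Defs.v *)
From HB Require Import structures.
From mathcomp Require Import all_boot all_order all_algebra.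
From mathcomp Require Import all_classical all_reals all_analysis.

Set Implicit Arguments.
Unset Strict Implicit.
Unset Printing Implicit Defensive.

Import Order.TTheory GRing.Theory Num.Theory.
Import numFieldNormedType.Exports.

Local Open Scope classical_set_scope.
Local Open Scope ring_scope.

(* [inZp] reduces modulo [m.+1]. *)
Definition digit (m n j : nat) : 'I_m.+1 := inZp (n %/ m.+1 ^ j).

(* For [0 < m], [trunc_log m.+1 n] is the position of the leading digit of [n]
   in base [m.+1] (and is 0 when [n = 0]). *)
Definition cantor_integer (m p : nat) (f : 'I_m.+1 -> 'I_p.+1) (n : nat) : nat :=
  (\sum_(j < (trunc_log m.+1 n).+1) f (digit m n j) * p.+1 ^ j)%N.

Lemma digit_expansion (m n k : nat) : (n < m.+1 ^ k)%N ->
  n = (\sum_(j < k) digit m n j * m.+1 ^ j)%N.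
Proof.
elim: k n => [|k IHk] n; first by rewrite big_ord0 expn0 ltnS leqn0 => /eqP.
move=> ltn; rewrite big_ord_recl /= expn0 divn1 muln1.
rewrite {1}(divn_eq n m.+1) addnC; congr (_ + _)%N.
rewrite {1}(IHk (n %/ m.+1)%N) ?big_distrl /=; last first.
  by rewrite ltn_divLR // -expnSr.
by apply: eq_bigr => j _; rewrite /bump /= add1n -divnMA -expnS -mulnA -expnSr.
Qed.

(* The value does not depend on the expansion chosen, leading zeros allowed. *)
Lemma cantor_integerE (m p : nat) (f : 'I_m.+1 -> 'I_p.+1) (k : nat)
    (e : nat -> 'I_m.+1) : (0 < m)%N -> f ord0 = ord0 ->
  cantor_integer f (\sum_(j < k.+1) e j * m.+1 ^ j)%N =
  (\sum_(j < k.+1) f (e j) * p.+1 ^ j)%N.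
Proof.
move=> m0 f0; set n := (X in cantor_integer f X).
have sum_lt i (g : nat -> 'I_m.+1) : (\sum_(j < i) g j * m.+1 ^ j < m.+1 ^ i)%N.
  elim: i => [|i IHi]; first by rewrite big_ord0 expn0.
  rewrite big_ord_recr /= expnS mulSn -addSn leq_add //.
  by rewrite leq_mul2r -ltnS ltn_ord orbT.
have dige i : (i < k.+1)%N -> digit m n i = e i.
  move=> ik; apply: val_inj => /=; rewrite /n.
  rewrite -(subnKC ik) big_split_ord /= big_ord_recr /=.
  set r := (k.+1 - i.+1)%N.
  have -> : (\sum_(j < r) e (i.+1 + j)%N * m.+1 ^ (i.+1 + j) =
      (\sum_(j < r) e (i.+1 + j)%N * m.+1 ^ j) * m.+1 * m.+1 ^ i)%N.
    rewrite -mulnA -expnS big_distrl /=.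
    by apply: eq_bigr => j _; rewrite expnD [(m.+1 ^ i.+1 * _)%N]mulnC mulnA.
  rewrite -addnA -mulnDl addnC divnMDl ?expn_gt0 // divn_small ?sum_lt //.
  by rewrite addn0 addnC modnMDl modn_small.
have ext a b : (n < m.+1 ^ a)%N -> (a <= b)%N ->
    (\sum_(j < a) f (digit m n j) * p.+1 ^ j =
     \sum_(j < b) f (digit m n j) * p.+1 ^ j)%N.
  move=> na ab; rewrite -(subnKC ab) big_split_ord /=.
  rewrite [X in (_ + X)%N]big1 ?addn0 // => j _.
  suff -> : digit m n (a + j) = ord0 by rewrite f0 mul0n.
  apply: val_inj; rewrite /= divn_small ?mod0n //.
  by rewrite (leq_trans na) // leq_exp2l // leq_addr.
transitivity (\sum_(j < k.+1) f (digit m n j) * p.+1 ^ j)%N; last first.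
  by apply: eq_bigr => j _; rewrite dige.
have nk : (n < m.+1 ^ k.+1)%N := sum_lt k.+1 e.
have nt : (n < m.+1 ^ (trunc_log m.+1 n).+1)%N by rewrite trunc_log_ltn.
rewrite /cantor_integer; case: (leqP (trunc_log m.+1 n) k) => h.
  exact: ext.
by apply/esym/ext => //; apply: ltnW.
Qed.

Definition cantor_exponent (R : realType) (m p : nat) : R :=
  ln p.+1%:R / ln m.+1%:R.

Definition cantor_ratios (R : realType) (m p : nat) (f : 'I_m.+1 -> 'I_p.+1) :
    set R :=
  [set (cantor_integer f n)%:R / (n%:R `^ cantor_exponent R m p)
     | n in [set n : nat | (1 <= n)%N]].
Arguments cantor_ratios R {m p} f.

(* Unlike [dense], which is relative to the whole space, this is relative to
   [B]; [closure] is taken in the ambient space. *)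
Definition dense_in (T : topologicalType) (A B : set T) : Prop :=
  A `<=` B /\ B `<=` closure A.

(* Main.v *)
(* Write g n = C_n / n^alpha and b = m+1. Since C_{b n} = (p+1) C_n, one has
   g (b n) = g n, so given g n1 <= y < g n2 both indices may be replaced by
   multiples N2 <= N1 with N2 as large as wanted. As C is increasing,
   g (n+1) >= g n (n/(n+1))^alpha: going right, g may jump up but decreases only
   by small steps. Hence the first n >= N2 with g n <= y has g n close to y. *)

Require Import Defs.
From mathcomp Require Import all_boot all_order all_algebra.
From mathcomp Require Import all_classical all_reals all_analysis.
From mathcomp Require Import lra.
Import Order.TTheory GRing.Theory Num.Theory.
Import numFieldNormedType.Exports.
Local Open Scope classical_set_scope.
Local Open Scope ring_scope.

(** Bernoulli's inequality; the induction step drops a term [n * x^2 >= 0]. *)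
Lemma one_subM_le_expr (R : realDomainType) (x : R) (n : nat) :
  0 <= x <= 1 -> 1 - n%:R * x <= (1 - x) ^+ n.
Proof.
move=> /andP[x0 x1]; elim: n => [|n IHn]; first by rewrite mul0r subr0 expr0.
rewrite exprS; apply: (@le_trans _ _ ((1 - x) * (1 - n%:R * x))).
  by have := mulr_ge0 (ler0n R n) (mulr_ge0 x0 x0); rewrite -natr1; nra.
by rewrite ler_wpM2l // subr_ge0.
Qed.

Section CantorIntegers.
Variables (m p : nat) (f : 'I_m.+1 -> 'I_p.+1).
Hypotheses (m_gt0 : (0 < m)%N) (p_gt0 : (0 < p)%N).
Hypothesis f_incr : forall i j : 'I_m.+1, (i < j)%N -> (f i < f j)%N.
Hypothesis f0 : f ord0 = ord0.

Local Notation C := (cantor_integer f).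

(** Putting [r] below the digits of [n] shifts the others up by one place. The later facts about [C]
    all come from this recursion. *)
Lemma cantor_integer_digit (n : nat) (r : 'I_m.+1) :
  C (n * m.+1 + r) = (C n * p.+1 + f r)%N.
Proof.
(* A crude nonzero digit count; the surplus digits are zeros. *)
have n_lt : (n < m.+1 ^ n.+1)%N.
  by rewrite (leq_trans (ltnSn n)) // ltnW // ltn_expl.
pose e j := if j is j'.+1 then digit m n j' else r.
rewrite [in C n](digit_expansion n_lt) cantor_integerE //.
have -> : (n * m.+1 + r = \sum_(j < n.+2) e j * m.+1 ^ j)%N.
  rewrite big_ord_recl /= expn0 muln1 addnC; congr (_ + _)%N.
  rewrite [in LHS](digit_expansion n_lt) big_distrl /=.
  by apply: eq_bigr => j _; rewrite -mulnA -expnSr.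
rewrite cantor_integerE // big_ord_recl /= expn0 muln1 addnC; congr (_ + _)%N.
by rewrite big_distrl /=; apply: eq_bigr => j _; rewrite -mulnA -expnSr.
Qed.

Lemma cantor_integer0 : C 0 = 0%N.
Proof.
(* The recursion at 0 reads [C 0 = C 0 * p.+1], with [p.+1 <> 1]. *)
apply/eqP; have := cantor_integer_digit 0 ord0.
rewrite f0 mul0n !addn0 => /eqP; rewrite -{1}[C 0]muln1 eqn_mul2l.
by rewrite eqSS (ltn_eqF p_gt0) orbF.
Qed.

Lemma cantor_integer_shift (k n : nat) :
  C (m.+1 ^ k * n) = (p.+1 ^ k * C n)%N.
Proof.
elim: k => [|k IHk]; first by rewrite !mul1n.
have := cantor_integer_digit (m.+1 ^ k * n) ord0.
by rewrite f0 !addn0 IHk ![(_ * _.+1)%N]mulnC !mulnA -!expnS.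
Qed.

Lemma divn_digit (n : nat) : n = (n %/ m.+1 * m.+1 + (inZp n : 'I_m.+1))%N.
Proof. exact: divn_eq. Qed.

(** If the quotients by [m.+1] agree, the last digits decide. Otherwise their images differ by at
    least 1, hence by [p.+1] after scaling, which outweighs a last digit of at most [p]. *)
Lemma cantor_integer_lt (n n' : nat) : (n < n')%N -> (C n < C n')%N.
Proof.
elim/ltn_ind: n' n => n' IHn n lt_nn'.
rewrite (divn_digit n) (divn_digit n') !cantor_integer_digit.
have : (n %/ m.+1 <= n' %/ m.+1)%N by rewrite leq_div2r // ltnW.
rewrite leq_eqVlt => /orP[/eqP eq_a|lt_a].
  rewrite eq_a ltn_add2l f_incr //.
  by move: lt_nn'; rewrite {1}(divn_digit n) {1}(divn_digit n') eq_a ltn_add2l.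
have lt_C : (C (n %/ m.+1) < C (n' %/ m.+1))%N.
  by apply: IHn => //; rewrite ltn_Pdiv // (leq_ltn_trans _ lt_nn').
apply: (@leq_trans ((C (n %/ m.+1)).+1 * p.+1)).
  by rewrite mulSn addnC -addSn leq_add2r.
by rewrite (leq_trans (leq_mul lt_C (leqnn p.+1))) // leq_addr.
Qed.

Lemma cantor_integer_bound (k n : nat) :
  (n < m.+1 ^ k)%N -> (C n < p.+1 ^ k)%N.
Proof.
elim: k n => [|k IHk] n n_lt.
  by move: n_lt; rewrite ltnS leqn0 => /eqP ->; rewrite cantor_integer0.
have /IHk lt_C : (n %/ m.+1 < m.+1 ^ k)%N by rewrite ltn_divLR // -expnSr.
rewrite (divn_digit n) cantor_integer_digit.
rewrite expnSr (leq_trans _ (leq_mul lt_C (leqnn p.+1))) //.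
by rewrite mulSn addnC ltn_add2r ltn_ord.
Qed.

Section Ratios.
Variable R : realType.

Local Notation alpha := (cantor_exponent R m p).
Local Notation g n := ((C n)%:R / (n%:R `^ alpha) : R).

Lemma cantor_exponent_ge0 : 0 <= alpha.
Proof. by rewrite divr_ge0 // ln_ge0 // ler1n. Qed.

Lemma powR_cantor_exponent (k : nat) :
  (m.+1 ^ k)%:R `^ alpha = (p.+1 ^ k)%:R :> R.
Proof.
have ln_m : ln m.+1%:R != 0 :> R by rewrite gt_eqF // ln_gt0 // ltr1n.
have base : m.+1%:R `^ alpha = p.+1%:R :> R.
  by rewrite /powR pnatr_eq0 /= divfK // lnK // posrE ltr0n.
by rewrite natrX -powR_mulrn // powRAC base powR_mulrn // natrX.
Qed.

Lemma cantor_ratio_ge0 (n : nat) : 0 <= g n.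
Proof. by rewrite divr_ge0 // powR_ge0. Qed.

Lemma cantor_ratio_shift (k n : nat) : g (m.+1 ^ k * n)%N = g n.
Proof.
rewrite cantor_integer_shift !natrM powRM // powR_cantor_exponent.
by rewrite -mulf_div divff ?mul1r // pnatr_eq0 expn_eq0.
Qed.

(** If [n] lies between the powers [k] and [k.+1] of [m.+1], then [C n] is below [p.+1 ^ k.+1] and
    [n^alpha] is at least [p.+1 ^ k]. *)
Lemma cantor_ratio_bound (n : nat) : (0 < n)%N -> g n <= p.+1%:R.
Proof.
move=> n_gt0; set k := trunc_log m.+1 n.
have n_pos : 0 < n%:R `^ alpha by rewrite powR_gt0 // ltr0n.
have /cantor_integer_bound /ltnW C_le : (n < m.+1 ^ k.+1)%N.
  by rewrite trunc_log_ltn.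
rewrite ler_pdivrMr //; apply: (@le_trans _ _ (p.+1 ^ k.+1)%:R).
  by rewrite ler_nat.
rewrite expnS natrM ler_wpM2l // -powR_cantor_exponent.
by rewrite ge0_ler_powR ?cantor_exponent_ge0 // ?nnegrE // ler_nat trunc_logP.
Qed.

(** Monotonicity of [C] loses only a factor [t^alpha], [t = n/(n+1)]. As [t <= 1], rounding [alpha]
    up to an integer lowers this factor, and Bernoulli then makes it linear in [1/(n+1)]. *)
Lemma cantor_ratio_step (n : nat) : (0 < n)%N ->
  g n * (1 - (Num.truncn alpha).+1%:R / n.+1%:R) <= g n.+1.
Proof.
move=> n_gt0; set d := (Num.truncn alpha).+1; set t : R := n%:R / n.+1%:R.
have t_gt0 : 0 < t by rewrite divr_gt0 // ltr0n.
have t_le1 : t <= 1 by rewrite ler_pdivrMr // mul1r ler_nat.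
have tE : t = 1 - n.+1%:R^-1.
  by rewrite /t -[X in X / _](addrK 1) natr1 mulrBl divff ?pnatr_eq0 // mul1r.
have t_alpha : 1 - d%:R / n.+1%:R <= t `^ alpha.
  apply: (@le_trans _ _ (t `^ d%:R)); last first.
    by apply: ger_powR; [exact/andP | exact/ltW/truncnS_gt].
  rewrite powR_mulrn ?(ltW t_gt0) // tE one_subM_le_expr //.
  by rewrite invr_ge0 ler0n invf_le1 ?ltr0n // ler1n.
apply: (le_trans (ler_wpM2l (cantor_ratio_ge0 n) t_alpha)).
rewrite /t powRM // ?invr_ge0 // -[n.+1%:R^-1]powR_inv1 // powRAC.
rewrite powR_inv1 ?powR_ge0 //.
rewrite mulrA divfK ?gt_eqF ?powR_gt0 ?ltr0n //.
by rewrite ler_wpM2r ?invr_ge0 ?powR_ge0 // ler_nat ltnW // cantor_integer_lt.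
Qed.

Lemma cantor_ratio_crossing (n1 n2 : nat) (y e : R) :
  (0 < n1)%N -> (0 < n2)%N -> 0 < e -> g n1 <= y < g n2 ->
  exists2 n : nat, (0 < n)%N & y - e < g n <= y.
Proof.
move=> n1_gt0 n2_gt0 e_gt0 /andP[le1 lt2].
have y_ge0 : 0 <= y := le_trans (cantor_ratio_ge0 n1) le1.
(* Past [K], the possible drop [y * d / n] is below [e]. *)
set d := (Num.truncn alpha).+1; pose K := (Num.truncn (y * d%:R / e)).+1.
have le_pow a b : (0 < b)%N -> (a <= m.+1 ^ a * b)%N.
  by move=> b0; apply: leq_trans (leq_pmulr _ b0); rewrite ltnW // ltn_expl.
pose N2 := (m.+1 ^ K * n2)%N; pose N1 := (m.+1 ^ N2 * n1)%N.
have exN : exists n, (N2 <= n)%N && (g n <= y).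
  by exists N1; rewrite le_pow //= cantor_ratio_shift.
case: (ex_minnP exN) => n /andP[le_N2n gn_le] min_n.
have N2_gt0 : (0 < N2)%N by rewrite muln_gt0 expn_gt0.
(* The ratio at [N2] exceeds [y], so the minimal [n] has a predecessor in the search range, whose
   ratio exceeds [y] too. *)
have lt_N2n : (N2 < n)%N.
  rewrite ltn_neqAle le_N2n andbT; apply: contraTneq gn_le => <-.
  by rewrite cantor_ratio_shift -ltNge.
case: n => [//|n] in le_N2n gn_le min_n lt_N2n *.
exists n.+1 => //; rewrite gn_le andbT.
have n_gt0 : (0 < n)%N := leq_trans N2_gt0 lt_N2n.
have gn_gt : y < g n.
  rewrite ltNge; apply/negP => gn_le'.
  by have := min_n n; rewrite gn_le' andbT -ltnS lt_N2n ltnn => /(_ isT).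
have d_lt : y * d%:R / n.+1%:R < e.
  rewrite ltr_pdivrMr ?ltr0n // [e * _]mulrC -ltr_pdivrMr //.
  apply: lt_le_trans (truncnS_gt _) _; rewrite ler_nat.
  by rewrite (leq_trans _ (ltnW lt_N2n)) // le_pow.
(* A negative factor cannot multiply [y < g n], but then [y <= y * d / n.+1 < e], so [y - e] is
   negative. *)
have [s_ge0|s_lt0] := leP 0 (1 - d%:R / n.+1%:R : R).
  apply: (lt_le_trans _ (cantor_ratio_step _ n_gt0)).
  apply: (lt_le_trans _ (ler_wpM2r s_ge0 (ltW gn_gt))).
  by rewrite mulrBr mulr1 mulrA ltrD2l ltrN2.
apply: lt_le_trans (cantor_ratio_ge0 _); rewrite subr_lt0.
by apply: le_lt_trans d_lt; rewrite -mulrA ler_peMr // ltW // -subr_lt0.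
Qed.

End Ratios.
End CantorIntegers.

Theorem theorem1p2 (R : realType) (m p : nat) (f : 'I_m.+1 -> 'I_p.+1)
    (hm : (0 < m)%N) (hmp : (m < p)%N)
    (hf : forall i j : 'I_m.+1, (i < j)%N -> (f i < f j)%N)
    (hf0 : f ord0 = ord0) (hfm : f ord_max = ord_max) :
  dense_in (cantor_ratios R f)
    `[inf (cantor_ratios R f), sup (cantor_ratios R f)].
Proof.
set A := cantor_ratios R f.
have p_gt0 : (0 < p)%N := ltn_trans hm hmp.
(* [inf] and [sup] default to 0 unless the set is nonempty and suitably bounded. *)
have A0 : A !=set0 by eexists; exists 1%N.
have A_lb : has_lbound A by exists 0 => _ [n _ <-]; exact: cantor_ratio_ge0.
have A_ub : has_ubound A.
  by exists p.+1%:R => _ [n n_gt0 <-]; exact: cantor_ratio_bound.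
split=> [x Ax|y]; rewrite /= in_itv /=.
  by rewrite ge_inf // ub_le_sup.
move=> /andP[inf_le le_sup] B /nbhs_ballP[e /= e_gt0 ballB].
suff [n n_gt0 /andP[lt_e lt_e']] : exists2 n : nat, (0 < n)%N &
    y - e < (cantor_integer f n)%:R / (n%:R `^ cantor_exponent R m p) < y + e.
  eexists; split; first by exists n.
  by apply: ballB; rewrite /ball /= ltr_distlC lt_e lt_e'.
have [_ [n1 n1_gt0 <-] lt1] := inf_adherent e_gt0 (conj A0 A_lb).
have [_ [n2 n2_gt0 <-] lt2] := sup_adherent e_gt0 (conj A0 A_ub).
have {}lt1 := lt_le_trans lt1 (lerD inf_le (lexx e)).
have {}lt2 := le_lt_trans (lerB le_sup (lexx e)) lt2.
(* The ratio at [n1] is below [y + e] and that at [n2] above [y - e]. Either one of them is already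
   close to [y], or they lie on both sides of [y] and the crossing applies. *)
have [gt1|le1] := ltP (y - e)
  ((cantor_integer f n1)%:R / (n1%:R `^ cantor_exponent R m p)).
  by exists n1; rewrite // gt1.
have [le2|gt2] := leP
  ((cantor_integer f n2)%:R / (n2%:R `^ cantor_exponent R m p)) y.
  by exists n2; rewrite // lt2 (le_lt_trans le2) // ltrDl.
have [|n n_gt0 /andP[gt_n le_n]] :=
  cantor_ratio_crossing _ _ _ hm hf hf0 _ _ _ y _ n1_gt0 n2_gt0 e_gt0.
  by rewrite gt2 andbT (le_trans le1) // gerBl ltW.
by exists n; rewrite // gt_n (le_lt_trans le_n) // ltrDl.
Qed.
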